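(* Consider the symmetric scalar two-player $\gamma$-discounted linear quadratic game, i.e. $\sigma_1=\sigma_2=\sigma>0$, with $a\neq0$, $\gamma\in(0,1]$, $r_1,r_2>0$, and let $(x^\star,x^\star)$ be a symmetric stable Feedback Nash Equilibrium. Then it is locally saddle if and only if it is not unique, i.e. if and only if the game admits other stable Feedback Nash Equilibria besides $(x^\star,x^\star)$.
   Context: For a player index $i\in\{1,2\}$, $-i$ denotes the other player. The game: the scalar state evolves as $s_{t+1}=a s_t+u_{1,t}+u_{2,t}$, $t=0,1,2,\dots$, with $a\in\mathbb{R}$, and each player uses a linear feedback $u_{i,t}=x_i s_t$ with policy $x_i\in\mathbb{R}$. For $x=(x_1,x_2)$ put $a_{\mathrm{cl}}(x)=a+x_1+x_2$, so $s_t=a_{\mathrm{cl}}(x)^t s_0$. Player $i$'s value function is $$V^{(i)}(s_0;x_i,x_{-i})=\sum_{t=0}^\infty \gamma^t r_i(\sigma_i s_t^2+u_{i,t}^2)=s_0^2 r_i(\sigma_i+x_i^2)\sum_{t=0}^\infty(\gamma a_{\mathrm{cl}}^2(x))^t\in[0,\infty].$$ A pair $x^\star=(x_1^\star,x_2^\star)\in\mathbb{R}^2$ is a Feedback Nash Equilibrium (FNE) if for all $s_0\in\mathbb{R}$, each player $i$ and each $x_i\in\mathbb{R}$, $V^{(i)}(s_0;x_i^\star,x_{-i}^\star)\le V^{(i)}(s_0;x_i,x_{-i}^\star)$. It is a stable FNE if in addition $|a_{\mathrm{cl}}(x^\star)|<1$. An FNE is symmetric if both policies are equal. For $x\neq0$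 define $$h_\pm^{(i)}(x)=\frac{\sigma_i-x(2a+x)}{2x}\pm\frac{\sqrt{\gamma^2(\sigma_i+x^2)^2+4\gamma x^2}}{2\gamma x}$$ (here with $\sigma_i=\sigma$). Let $F=(F_i,F_{-i})$ with $F_i(x_i,x_{-i})=\gamma x_i\,(x_{-i}-h_-^{(i)}(x_i))(x_{-i}-h_+^{(i)}(x_i))$ and $F_{-i}(x_i,x_{-i})=\gamma x_{-i}\,(x_i-h_-^{(-i)}(x_{-i}))(x_i-h_+^{(-i)}(x_{-i}))$, and let $J_F$ be its Jacobian matrix with respect to $(x_i,x_{-i})$. A stable FNE is (locally) saddle if the eigenvalues of $J_F$ at it have opposite signs, i.e. $\det J_F<0$ at that point. *)

(* Defs.v *)
From HB Require Import structures.
From mathcomp Require Import all_boot all_order all_algebra.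
From mathcomp Require Import all_classical all_reals all_analysis.
Set Implicit Arguments.
Unset Strict Implicit.
Unset Printing Implicit Defensive.
Import Order.TTheory GRing.Theory Num.Theory.
Import numFieldNormedType.Exports.
Local Open Scope ring_scope.

(* Policy profiles are row vectors; the players are the two elements of 'I_2,
   and [other] is the index usually written -i. *)
Definition other (i : 'I_2) : 'I_2 := rev_ord i.

Section Game.
Variables (R : realType) (a gamma : R) (sigma r : 'I_2 -> R).

(* y is the player's own policy and z the opponent's. *)
Fixpoint state (y z s0 : R) (t : nat) : R :=
  if t is t'.+1 then
    let s := state y z s0 t' in a * s + y * s + z * s
  else s0.

(* The series is taken in the extended reals: divergence gives +oo. *)
Definition value (i : 'I_2) (s0 y z : R) : \bar R :=
  (\sum_(0 <= t <oo)
     (gamma ^+ t * (r i * (sigma i * state y z s0 t ^+ 2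
                           + (y * state y z s0 t) ^+ 2)))%:E)%E.

Definition closed_loop (x : 'rV[R]_2) : R := a + x 0 0 + x 0 1.

Definition fne (x : 'rV[R]_2) : Prop :=
  forall (s0 : R) (i : 'I_2) (y : R),
    (value i s0 (x 0 i)%R (x 0 (other i))%R <= value i s0 y (x 0 (other i))%R)%E.

Definition stable_fne (x : 'rV[R]_2) : Prop :=
  fne x /\ `|closed_loop x| < 1.

Definition symmetric_profile (x : 'rV[R]_2) : Prop := x 0 0 = x 0 1.

Definition h_minus (i : 'I_2) (y : R) : R :=
  (sigma i - y * (2 * a + y)) / (2 * y)
  - Num.sqrt (gamma ^+ 2 * (sigma i + y ^+ 2) ^+ 2 + 4 * gamma * y ^+ 2)
    / (2 * gamma * y).

Definition h_plus (i : 'I_2) (y : R) : R :=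
  (sigma i - y * (2 * a + y)) / (2 * y)
  + Num.sqrt (gamma ^+ 2 * (sigma i + y ^+ 2) ^+ 2 + 4 * gamma * y ^+ 2)
    / (2 * gamma * y).

(* h_minus and h_plus are meaningful for y != 0 only; at y = 0 division by zero
   yields 0 and the entry is 0.  When a and the parameters sigma, gamma, r are
   nonzero resp. positive, both policies of a symmetric equilibrium are nonzero,
   so this convention does not affect the Jacobian there. *)
Definition F (x : 'rV[R]_2) : 'rV[R]_2 :=
  \row_i (gamma * x 0 i * (x 0 (other i) - h_minus i (x 0 i))
                        * (x 0 (other i) - h_plus i (x 0 i))).

(* [jacobian] acts on row vectors, hence is the transpose of the usual Jacobian
   matrix; the eigenvalues are the same. *)
Definition locally_saddle (x : 'rV[R]_2) : Prop :=
  exists l m : R,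
    [/\ eigenvalue (jacobian F x) l, eigenvalue (jacobian F x) m & l < 0 < m].

End Game.

(* Main.v *)
Require Import Defs.
From HB Require Import structures.
From mathcomp Require Import all_boot all_order all_algebra.
From mathcomp Require Import all_classical all_reals all_analysis.
From mathcomp Require Import ring lra.
Set Implicit Arguments.
Unset Strict Implicit.
Unset Printing Implicit Defensive.
Import Order.TTheory GRing.Theory Num.Theory.
Import numFieldNormedType.Exports.
Local Open Scope ring_scope.

(** Write c for the closed loop of a profile, b = a + z for the loop that a
    player faces against the opponent policy z, and s for sigma.

    Equilibria.  When gamma * c ^ 2 < 1, the cost of the policy y from a nonzero
    initial state is a positive multiple of
    (s + y ^ 2) / (1 - gamma * c ^ 2) with c = b + y, and y is a best response
    exactly when the half-numerator of the derivative,
      y * (1 - gamma * c ^ 2) + gamma * (s + y ^ 2) * c,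
    vanishes ([best_response_stationarity]).  A stable equilibrium is
    therefore a pair of roots of one and the same equation with parameter c
    such that |c| < 1 and a + y + z = c ([stable_fneP]).

    Saddles.  Off the axes F is polynomial, since h_minus and h_plus are the
    two roots of a quadratic ([F_entry]).  At (w, w) its Jacobian has equal
    diagonal entries A and equal off-diagonal entries B, hence the eigenvalues
    A + B and A - B.  Stationarity forces A + B < 0
    ([symmetric_mode_negative]), and A - B = gamma * a * c - 1, so the
    equilibrium is a saddle exactly when 1 < gamma * a * c
    ([saddle_iff_loop_gain]).

    Other equilibria.  Two distinct policies y, z are both stationary exactly
    when their closed loop is d = 1 / (gamma * a) and y * z = s
    ([asymmetric_stationary]); as y + z = d - a, such real policies exist
    exactly when 4 * s < (d - a) ^ 2.  A symmetric pair is stationary exactly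
    when its closed loop is a root of the cubic [loop_cubic], which on the
    region gamma * d ^ 2 < 1 has the sign of d - c once c is a root in that
    region ([loop_cubic_sign]).  So there is no second symmetric equilibrium.
    At d = 1 / (gamma * a) the value of the cubic is
    (4 * s - (d - a) ^ 2) / a, and comparing signs turns the discriminant
    condition into 1 < gamma * a * c again ([discriminant_sign]).  In the
    direction from the saddle, 1 < gamma * a * c also gives |d| < |c| < 1, so
    that the new equilibrium is stable. *)

(** * Discounted costs and best responses *)

Lemma geometric_eseries (R : realType) (k q : R) :
  0 <= q < 1 -> (\sum_(0 <= t <oo) (k * q ^+ t)%:E = (k / (1 - q))%:E)%E.
Proof.
move=> /andP[q_ge0 q_lt1]; apply/cvg_lim => //.
apply: cvg_EFin; first by apply: nearW => n /=; rewrite sumEFin.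
rewrite [X in (X @ _ --> _)%classic](_ : _ = series (geometric k q)); last first.
  by apply/funext => n; rewrite /= sumEFin.
by apply: cvg_geometric_series; rewrite ger0_norm.
Qed.

Lemma geometric_eseries_divergent (R : realType) (k q : R) :
  0 < k -> 1 <= q -> (\sum_(0 <= t <oo) (k * q ^+ t)%:E = +oo)%E.
Proof.
move=> k_gt0 q_ge1; apply: eq_infty => l.
pose n := Num.bound (l / k).
have terms_ge0 t : (0 <= (k * q ^+ t)%:E)%E.
  by rewrite lee_fin mulr_ge0 ?exprn_ge0 ?ltW // (lt_le_trans ltr01).
apply: (@le_trans _ _ (\sum_(0 <= t < n) (k * q ^+ t)%:E)%E); last first.
  by apply: nneseries_lim_ge => t _ _.
rewrite sumEFin lee_fin.
apply: (@le_trans _ _ (\sum_(0 <= t < n) k)); last first.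
  by apply: ler_sum => t _; rewrite ler_peMr ?exprn_ege1 // ltW.
rewrite sumr_const_nat subn0 -[k *+ n]mulr_natl -ler_pdivrMr //.
have [lk_ge0|/ltW lk_le0] := leP 0 (l / k); last exact: le_trans (ler0n _ _).
by apply: ltW; rewrite archi_boundP.
Qed.

Lemma state_geometric (R : realType) (a y z s0 : R) t :
  state a y z s0 t = (a + y + z) ^+ t * s0.
Proof.
elim: t => [|t IH] /=; first by rewrite mul1r.
by rewrite IH exprS; ring.
Qed.

Section Value.
Variables (R : realType) (a gamma : R) (sigma r : 'I_2 -> R).
Hypothesis gamma_gt0 : 0 < gamma.

Lemma value_geometric (i : 'I_2) (s0 y z : R) :
  value a gamma sigma r i s0 y z =
  (\sum_(0 <= t <oo) (r i * (sigma i + y ^+ 2) * s0 ^+ 2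
                      * (gamma * (a + y + z) ^+ 2) ^+ t)%:E)%E.
Proof.
apply: eq_eseriesr => t _; congr (_%:E).
by rewrite state_geometric [(gamma * _) ^+ t]exprMn exprAC; ring.
Qed.

Lemma value_stable (i : 'I_2) (s0 y z : R) :
  gamma * (a + y + z) ^+ 2 < 1 ->
  value a gamma sigma r i s0 y z =
  (r i * (sigma i + y ^+ 2) * s0 ^+ 2 / (1 - gamma * (a + y + z) ^+ 2))%:E.
Proof.
move=> q_lt1; rewrite value_geometric geometric_eseries //.
by rewrite q_lt1 mulr_ge0 ?sqr_ge0 // ltW.
Qed.

Lemma value_unstable (i : 'I_2) (s0 y z : R) :
  0 < r i -> 0 < sigma i -> s0 != 0 -> 1 <= gamma * (a + y + z) ^+ 2 ->
  value a gamma sigma r i s0 y z = +oo%E.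
Proof.
move=> r_gt0 sigma_gt0 s0_neq0 q_ge1.
rewrite value_geometric geometric_eseries_divergent //.
apply: mulr_gt0; last by rewrite exprn_even_gt0.
by apply: mulr_gt0 => //; rewrite ltr_wpDr ?sqr_ge0.
Qed.

Lemma value_at_rest (i : 'I_2) (y z : R) : value a gamma sigma r i 0 y z = 0%E.
Proof.
rewrite value_geometric eseries0 // => t _ _.
by rewrite expr0n /= mulr0 mul0r.
Qed.

(** Half the numerator of the derivative of
    (sigma + y ^ 2) / (1 - gamma * c ^ 2) in the policy y, where the closed
    loop c moves along with y. *)
Definition stationarity (s y c : R) : R :=
  y * (1 - gamma * c ^+ 2) + gamma * (s + y ^+ 2) * c.

(** The cross-multiplied cost difference is quadratic in the deviation
    [y' - y], and nonnegative also when the deviation destabilizes the loop,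
    because then the subtracted product is nonpositive.  Being nonnegative on
    the whole line with positive leading coefficient, it has no linear term;
    evaluating it at its vertex shows this without any limit argument. *)
Lemma best_response_stationarity (i : 'I_2) (y z : R) :
  0 < r i -> 0 < sigma i -> gamma * (a + y + z) ^+ 2 < 1 ->
  (forall s0 y', (value a gamma sigma r i s0 y z
                  <= value a gamma sigma r i s0 y' z)%E) <->
  stationarity (sigma i) y (a + y + z) = 0.
Proof.
move=> r_gt0 sigma_gt0; set c := a + y + z => q_lt1.
pose n := stationarity (sigma i) y c.
pose m := (1 - gamma * c ^+ 2) + gamma * (sigma i + y ^+ 2).
have cost_gt0 w : 0 < sigma i + w ^+ 2 by rewrite ltr_wpDr ?sqr_ge0.
have m_gt0 : 0 < m by rewrite addr_gt0 ?subr_gt0 // mulr_gt0.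
have deviation d :
    (sigma i + (y + d) ^+ 2) * (1 - gamma * c ^+ 2)
    - (sigma i + y ^+ 2) * (1 - gamma * (a + (y + d) + z) ^+ 2)
    = 2 * d * n + d ^+ 2 * m.
  by rewrite /n /m /stationarity /c; ring.
split=> [opt | n_eq0 s0 y'].
- have quad_ge0 d : 0 <= 2 * d * n + d ^+ 2 * m.
    rewrite -deviation subr_ge0.
    have [q'_lt1|q'_ge1] := ltP (gamma * (a + (y + d) + z) ^+ 2) 1; last first.
      apply: (@le_trans _ _ 0).
        by apply: mulr_ge0_le0; [exact: ltW | rewrite subr_le0].
      by apply: mulr_ge0; [exact: ltW | rewrite subr_ge0 ltW].
    have := opt 1 (y + d); rewrite !value_stable // lee_fin expr1n !mulr1.
    rewrite ler_pdivrMr ?subr_gt0 // mulrAC ler_pdivlMr ?subr_gt0 //.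
    by rewrite -!mulrA ler_pM2l.
  (* The vertex of the parabola d |-> 2 * d * n + d ^ 2 * m. *)
  have := quad_ge0 (- n / m).
  have -> : 2 * (- n / m) * n + (- n / m) ^+ 2 * m = - (n ^+ 2 / m).
    by field; rewrite gt_eqF.
  rewrite oppr_ge0 pmulr_lle0 ?invr_gt0 // => n2_le0.
  by apply/eqP; rewrite -sqrf_eq0 eq_le n2_le0 sqr_ge0.
- have [->|s0_neq0] := eqVneq s0 0; first by rewrite !value_at_rest.
  have [q'_lt1|q'_ge1] := ltP (gamma * (a + y' + z) ^+ 2) 1; last first.
    by rewrite [X in (_ <= X)%E]value_unstable ?leey.
  rewrite !value_stable // lee_fin.
  rewrite ler_pdivrMr ?subr_gt0 // [leRHS]mulrAC ler_pdivlMr ?subr_gt0 //.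
  rewrite [leLHS]mulrAC [leRHS]mulrAC ler_wpM2r ?sqr_ge0 //.
  rewrite -!mulrA ler_pM2l // -subr_ge0.
  have := deviation (y' - y); rewrite subrKC => ->.
  by rewrite -/n in n_eq0; rewrite n_eq0 mulr0 add0r mulr_ge0 ?sqr_ge0 // ltW.
Qed.
End Value.

(** * The Jacobian of F *)

Lemma other_eq (i j : 'I_2) : (other i == j) = (j != i).
Proof. by move: i j; case=> [[|[|//]]] ? [[|[|//]]]. Qed.

Lemma other0 : other 0 = 1.
Proof. by apply/eqP; rewrite other_eq. Qed.

Lemma other1 : other 1 = 0.
Proof. by apply/eqP; rewrite other_eq. Qed.

Lemma ord2_cases (i : 'I_2) : i = 0 \/ i = 1.
Proof.
by case: i => [[|[|//]]] ?; [left | right]; apply/val_inj.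
Qed.

(** Being differentiable at a point, and the value of the differential there,
    depend only on the germ of the map.  This is what allows F, whose formula
    contains divisions and square roots, to be differentiated through its
    polynomial form. *)
Section NearDiff.
Variables (R : numFieldType) (V W : normedModType R) (f g : V -> W) (x : V).
Hypotheses (fg : {near x, f =1 g}) (dg : differentiable g x).

Let expansion : f \o shift x = cst (f x) + 'd g x +o_ 0 id.
Proof.
apply/eqaddoP => _/posnumP[e].
have /eqaddoP/(_ e%:num (gt0 e)) := diff_locally dg.
apply: filter_app.
have : \forall h \near (0 : V), f (h + x) = g (h + x).
  by rewrite (near_shift x) sub0r; apply: filterS fg => y /=; rewrite subrK.
apply: filter_app; apply: nearW => h fgh.
by rewrite !fctE /= fgh (nbhs_singleton fg).
Qed.

Lemma near_eq_diff : 'd f x = 'd g x :> (V -> W).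
Proof. by apply: diff_unique expansion; exact: diff_continuous. Qed.

Lemma near_eq_differentiable : differentiable f x.
Proof.
apply/diff_locallyP; rewrite near_eq_diff; split; last exact: expansion.
exact: diff_continuous.
Qed.
End NearDiff.

Lemma is_diff_coord (R : numFieldType) m n (M : 'M[R]_(m.+1, n.+1)) i j :
  is_diff M (fun N : 'M[R]_(m.+1, n.+1) => N i j : R) (fun N => N i j).
Proof.
pose f (N : 'M[R]_(m.+1, n.+1)) : R := N i j.
have f_lin : linear f by move=> k u v; rewrite /f !mxE.
pose fM := GRing.isLinear.Build _ _ _ _ _ f_lin.
pose fL : {linear _ -> _} := HB.pack f fM.
apply: DiffDef; first exact: differentiable_coord.
by rewrite -[LHS]/('d fL M : _ -> _) diff_lin //; exact: coord_continuous.
Qed.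

(** A row-valued map is the sum of its entries times the basis vectors, so
    differentiability can be checked entry by entry. *)
Lemma differentiable_row (R : numFieldType) (V : normedModType R) n
    (f : V -> 'rV[R]_n.+1) (x : V) :
  (forall i, differentiable (fun q => f q 0 i : R) x) -> differentiable f x.
Proof.
move=> df.
have -> : f = \sum_i (fun q => f q 0 i *: delta_mx 0 i).
  by apply/funext => q; rewrite fct_sumE; exact: row_sum_delta.
by apply: differentiable_sum => i; apply: differentiableZl; exact: df.
Qed.

Lemma diff_entry (R : numFieldType) (V : normedModType R) n
    (f : V -> 'rV[R]_n.+1) (x v : V) i :
  differentiable f x ->
  'd f x v 0 i = 'd (fun q => f q 0 i : R) x v.
Proof.
move=> df; have dc := is_diff_coord (f x) 0 i.
rewrite -[RHS]/('d ((fun M : 'rV[R]_n.+1 => M 0 i : R) \o f) x v).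
by rewrite [in RHS]diff_comp //= diff_val.
Qed.

Section Jacobian.
Variables (R : realType) (a gamma : R) (sigma : 'I_2 -> R).
Hypothesis gamma_gt0 : 0 < gamma.

(** The negative of the stationarity condition of policy y against opponent
    policy z, written as a quadratic in a + z. *)
Definition response_poly (s y z : R) : R :=
  gamma * y * (a + z) ^+ 2 + gamma * (y ^+ 2 - s) * (a + z)
  - (1 + gamma * s) * y.

(** The points h_minus and h_plus differ from their midpoint by a square root
    over 2 * gamma * y; the product of the two factors of F is a difference of
    squares, in which the square root disappears. *)
Lemma F_entry (x : 'rV[R]_2) (i : 'I_2) :
  x 0 i != 0 ->
  F a gamma sigma x 0 i = response_poly (sigma i) (x 0 i) (x 0 (other i)).
Proof.
rewrite mxE /h_minus /h_plus /response_poly => y_neq0.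
set y := x 0 i in y_neq0 *; set z := x 0 (other i).
set d := _ + 4 * gamma * y ^+ 2.
have d_ge0 : 0 <= d.
  by apply: addr_ge0; apply: mulr_ge0; rewrite ?sqr_ge0 // mulr_ge0 // ltW.
have : Num.sqrt d ^+ 2 = d by rewrite sqr_sqrtr.
set w := Num.sqrt d; move=> w2.
set p := sigma i - y * (2 * a + y).
have -> : gamma * y * (z - (p / (2 * y) - w / (2 * gamma * y)))
            * (z - (p / (2 * y) + w / (2 * gamma * y)))
          = (gamma ^+ 2 * (2 * y * z - p) ^+ 2 - w ^+ 2) / (4 * gamma * y).
  by field; rewrite y_neq0 gt_eqF.
by rewrite w2 /d /p; field; rewrite y_neq0 gt_eqF.
Qed.

Lemma is_diff_response_poly (s : R) (x : 'rV[R]_2) (i k : 'I_2) :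
  is_diff x (fun q : 'rV[R]_2 => response_poly s (q 0 i) (q 0 k))
    (fun v => let y := x 0 i in let b := a + x 0 k in
       (gamma * b ^+ 2 + 2 * gamma * y * b - (1 + gamma * s)) * v 0 i
       + (2 * gamma * y * b + gamma * (y ^+ 2 - s)) * v 0 k).
Proof.
pose y (q : 'rV[R]_2) : R := q 0 i; pose b (q : 'rV[R]_2) : R := q 0 k.
have dy : is_diff x y y := is_diff_coord x 0 i.
have db : is_diff x b b := is_diff_coord x 0 k.
rewrite [X in is_diff_def _ X](_ : _ = gamma *: (y * (cst a + b) ^+ 2)
   + gamma *: ((y ^+ 2 - cst s) * (cst a + b)) - (1 + gamma * s) *: y); last first.
  apply/funext => q; rewrite /response_poly !fctE /= /GRing.scale /= /y /b; ring.
have ds := is_diff_cst s x.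
have dab := is_diffD (is_diff_cst a x) db.
have dquad := is_diffZ gamma (is_diffM dy (is_diffX 1 dab)).
have dlin := is_diffZ gamma (is_diffM (is_diffB (is_diffX 1 dy) ds) dab).
apply: is_diff_eq (is_diffB (is_diffD dquad dlin) (is_diffZ (1 + gamma * s) dy)) _.
apply/funext => v; rewrite !fctE /= /GRing.scale /= /y /b.
have -> : (0 : 'rV[R]_2 -> R) v = 0 by [].
ring.
Qed.

(** The row index j is the variable of differentiation and the column index i
    the component of F, because Jacobian matrices act on row vectors. *)
Lemma jacobianF (x : 'rV[R]_2) (j i : 'I_2) :
  (forall k, x 0 k != 0) ->
  jacobian (F a gamma sigma) x j i =
  let y := x 0 i in let b := a + x 0 (other i) in
  if j == i then gamma * b ^+ 2 + 2 * gamma * y * b - (1 + gamma * sigma i)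
  else 2 * gamma * y * b + gamma * (y ^+ 2 - sigma i).
Proof.
move=> x_neq0.
have F_poly k : \forall q \near x, F a gamma sigma q 0 k
                  = response_poly (sigma k) (q 0 k) (q 0 (other k)).
  have := cvgr_neq0 (FF := nbhs_filter x) (x 0 k) (@coord_continuous R 1 2 0 k x)
                        (x_neq0 k).
  by apply: filterS => q /F_entry.
have dp k := is_diff_response_poly (sigma k) x k (other k).
have dF : differentiable (F a gamma sigma) x.
  apply: differentiable_row => k; apply: near_eq_differentiable (F_poly k) _.
  by case: (dp k).
have [poly_diff poly_val] := dp i.
rewrite mxE diff_entry // (near_eq_diff (F_poly i) poly_diff) poly_val /= !mxE /=.
rewrite other_eq [i == j]eq_sym; case: eqP => _ /=.
  by rewrite mulr1 mulr0 addr0.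
by rewrite mulr1 mulr0 add0r.
Qed.
End Jacobian.

(** * Stationary pairs *)

(** The matrix commutes with the exchange of the two coordinates, so the
    vectors (1, 1) and (1, -1) diagonalize it. *)
Section ExchangeSymmetric.
Variables (R : realType) (A B : R) (M : 'M[R]_2).
Hypothesis M_entry : forall j i, M j i = if j == i then A else B.

Lemma eigenvalue_exchange (l : R) :
  eigenvalue M l <-> l = A + B \/ l = A - B.
Proof.
have entry v i : (v *m M) 0 i = v 0 0 * M 0 i + v 0 1 * M 1 i :> R.
  by rewrite mxE !big_ord_recl big_ord0 addr0; congr (_ * _ + v 0 _ * M _ i);
     apply/val_inj.
split.
- move=> /eigenvalueP[v vM v_neq0].
  have := congr1 (fun u : 'rV_2 => u 0 1) vM.
  have := congr1 (fun u : 'rV_2 => u 0 0) vM.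
  rewrite !entry !mxE !M_entry /= => eq0 eq1.
  have sum0 : (v 0 0 + v 0 1) * (A + B - l) = 0 by lra.
  have dif0 : (v 0 0 - v 0 1) * (A - B - l) = 0 by lra.
  have [l_sum|l_sum] := eqVneq l (A + B); first by left.
  have [l_dif|l_dif] := eqVneq l (A - B); first by right.
  case/eqP: v_neq0.
  move/eqP: sum0; rewrite mulf_eq0 [X in _ || X]subr_eq0 [_ == l]eq_sym.
  rewrite (negPf l_sum) orbF.
  move/eqP: dif0; rewrite mulf_eq0 [X in _ || X]subr_eq0 [_ == l]eq_sym.
  rewrite (negPf l_dif) orbF.
  move=> /eqP e1 /eqP e2; apply/rowP => i; rewrite mxE.
  by case: (ord2_cases i) => ->; lra.
- pose v (e : R) : 'rV[R]_2 := \row_i (if i == 0 then 1 else e).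
  have v_neq0 e : v e != 0.
    by apply/eqP => /rowP /(_ 0); rewrite !mxE /=; apply/eqP; rewrite oner_eq0.
  case=> ->; apply/eigenvalueP; [exists (v 1) | exists (v (-1))] => //;
    apply/rowP => i; rewrite entry !mxE !M_entry /=;
    by case: (ord2_cases i) => -> /=; lra.
Qed.
End ExchangeSymmetric.

Section SymmetricStationary.
Variables (R : realType) (a gamma s : R).
Hypotheses (a_neq0 : a != 0) (gamma_gt0 : 0 < gamma) (s_gt0 : 0 < s).

Definition loop_cubic (c : R) : R :=
  - gamma * c ^+ 3 + (2 + 4 * gamma * s + gamma * a ^+ 2) * c - 2 * a.

Lemma loop_cubicE (w : R) :
  loop_cubic (a + w + w) = 4 * stationarity gamma s w (a + w + w).
Proof. by rewrite /loop_cubic /stationarity; ring. Qed.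

(** The quotient k = (loop_cubic d - loop_cubic c) / (d - c) is
    K - gamma * (c ^ 2 + c * d + d ^ 2), with K the linear coefficient of the
    cubic.  It can be negative on the square gamma * c ^ 2, gamma * d ^ 2 < 1;
    it is positive because c is a root.  With u = sqrt gamma * c,
    v = sqrt gamma * d and alpha = sqrt gamma * a, the root equation is
    u ^ 3 = K * u - 2 * alpha, and dividing the values of
    K * v - v ^ 3 - 2 * alpha at v = 1 and at v = -1, which are (1 - alpha) ^ 2 + 4 * gamma * s and
    - ((1 + alpha) ^ 2 + 4 * gamma * s), by 1 - u and -1 - u shows that k is
    positive at v = 1 and at v = -1.  As k is concave in v, it is positive in
    between. *)
Lemma loop_cubic_sign (c d : R) :
  gamma * c ^+ 2 < 1 -> gamma * d ^+ 2 < 1 -> loop_cubic c = 0 ->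
  exists2 k, 0 < k & loop_cubic d = (d - c) * k.
Proof.
move=> c_small d_small c_root.
exists (2 + 4 * gamma * s + gamma * a ^+ 2
        - gamma * (c ^+ 2 + c * d + d ^+ 2)); last first.
  by rewrite -[LHS]subr0 -c_root /loop_cubic; ring.
set g := Num.sqrt gamma.
have g2 : gamma = g ^+ 2 by rewrite sqr_sqrtr // ltW.
have g_gt0 : 0 < g by rewrite sqrtr_gt0.
set K := 2 + _ + _.
set u := g * c; set v := g * d.
have -> : gamma * (c ^+ 2 + c * d + d ^+ 2) = u ^+ 2 + u * v + v ^+ 2.
  by rewrite g2 /u /v; ring.
have unit_ball t : gamma * t ^+ 2 < 1 -> -1 < g * t < 1.
  move=> t_small; rewrite -ltr_norml.
  by rewrite -(@expr_lt1 _ 2) // real_normK ?num_real // exprMn -g2.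
have /andP[u_gtN1 u_lt1] : -1 < u < 1 := unit_ball _ c_small.
have /andP[v_gtN1 v_lt1] : -1 < v < 1 := unit_ball _ d_small.
have u_root : u ^+ 3 = K * u - 2 * (g * a).
  have : g * loop_cubic c = 0 by rewrite c_root mulr0.
  by rewrite /loop_cubic -/K g2 /u => e; lra.
have gs_gt0 : 0 < 4 * gamma * s by rewrite !mulr_gt0.
have hi : 0 < (1 - u) * (K - 1 - u - u ^+ 2).
  have -> : (1 - u) * (K - 1 - u - u ^+ 2) = (1 - g * a) ^+ 2 + 4 * gamma * s.
    have -> : (1 - u) * (K - 1 - u - u ^+ 2) = K - 1 - K * u + u ^+ 3 by ring.
    by rewrite u_root /K g2; ring.
  by rewrite ltr_wpDl ?sqr_ge0.
have lo : 0 < (1 + u) * (K - 1 + u - u ^+ 2).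
  have -> : (1 + u) * (K - 1 + u - u ^+ 2) = (1 + g * a) ^+ 2 + 4 * gamma * s.
    have -> : (1 + u) * (K - 1 + u - u ^+ 2) = K - 1 + K * u - u ^+ 3 by ring.
    by rewrite u_root /K g2; ring.
  by rewrite ltr_wpDl ?sqr_ge0.
rewrite pmulr_rgt0 ?subr_gt0 // in hi.
have u_gt : 0 < 1 + u by lra.
rewrite pmulr_rgt0 // in lo.
(* Interpolation between v = 1 and v = -1, with the concavity defect last. *)
have -> : K - (u ^+ 2 + u * v + v ^+ 2)
  = (1 + v) / 2 * (K - 1 - u - u ^+ 2) + (1 - v) / 2 * (K - 1 + u - u ^+ 2)
    + (1 - v) * (1 + v) by field.
by rewrite !addr_gt0 // !mulr_gt0 //; lra.
Qed.

(** With closed loop 0 stationarity would force both policies to be 0, and then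
    a itself would be 0. *)
Lemma stationary_loop_neq0 (w z : R) :
  let c := a + w + z in
  stationarity gamma s w c = 0 -> stationarity gamma s z c = 0 -> c != 0.
Proof.
move=> c w_stat z_stat; apply/eqP => c_eq0; case/eqP: a_neq0.
move: w_stat z_stat; rewrite c_eq0 /stationarity expr0n /= => w_eq0 z_eq0.
by move: c_eq0; rewrite /c; lra.
Qed.

Lemma stationary_opposes_loop (y c : R) :
  gamma * c ^+ 2 < 1 -> c != 0 -> stationarity gamma s y c = 0 -> y * c < 0.
Proof.
move=> c_small c_neq0 y_stat.
have -> : y * c = - (gamma * (s + y ^+ 2) * c ^+ 2 / (1 - gamma * c ^+ 2)).
  have d_neq0 : 1 - gamma * c ^+ 2 != 0 by rewrite gt_eqF ?subr_gt0.
  apply: (mulIf d_neq0); rewrite mulNr divfK //.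
  move: y_stat; rewrite /stationarity => e.
  by rewrite -[RHS]addr0 -(mul0r c) -e; ring.
rewrite oppr_lt0 divr_gt0 ?subr_gt0 // mulr_gt0 ?exprn_even_gt0 //.
by rewrite mulr_gt0 // ltr_wpDr ?sqr_ge0.
Qed.

(** This is the eigenvalue of the Jacobian at (w, w) along (1, 1).  It equals
    gamma * c ^ 2 - 1 + 2 * gamma * (w * b - s), and stationarity reads
    w = gamma * (w * b - s) * c; since w and c have opposite signs,
    w * b - s is negative. *)
Lemma symmetric_mode_negative (w : R) :
  let b := a + w in let c := a + w + w in
  gamma * c ^+ 2 < 1 -> stationarity gamma s w c = 0 ->
  gamma * b ^+ 2 + 2 * gamma * w * b - (1 + gamma * s)
  + (2 * gamma * w * b + gamma * (w ^+ 2 - s)) < 0.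
Proof.
move=> b c c_small w_stat.
have c_neq0 : c != 0 by apply: stationary_loop_neq0.
have wc_lt0 := stationary_opposes_loop c_small c_neq0 w_stat.
have : gamma * (w * b - s) < 0.
  have c2_gt0 : 0 < c ^+ 2 by rewrite exprn_even_gt0.
  rewrite -(pmulr_llt0 _ c2_gt0).
  suff -> : gamma * (w * b - s) * c ^+ 2 = w * c by [].
  rewrite -[RHS]subr0 -(mul0r c) -w_stat /stationarity /b /c; ring.
have -> : gamma * b ^+ 2 + 2 * gamma * w * b - (1 + gamma * s)
  + (2 * gamma * w * b + gamma * (w ^+ 2 - s))
  = gamma * c ^+ 2 - 1 + 2 * (gamma * (w * b - s)).
  by rewrite /b /c; ring.
lra.
Qed.

(** Given c, both policies are roots of the quadratic
    gamma * c * Y ^ 2 + (1 - gamma * c ^ 2) * Y + gamma * s * c.  When they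
    differ, the product of the roots is s, and the sum of the roots, which is
    c - a, gives gamma * a * c = 1. *)
Lemma asymmetric_stationary (y z : R) :
  let c := a + y + z in y != z ->
  (stationarity gamma s y c = 0 /\ stationarity gamma s z c = 0) <->
  gamma * a * c = 1 /\ y * z = s.
Proof.
move=> c yz; have yz0 : y - z != 0 by rewrite subr_eq0.
have factor : gamma * a * c = 1 ->
    stationarity gamma s y c = gamma * c * (s - y * z)
    /\ stationarity gamma s z c = gamma * c * (s - y * z).
  move=> gac.
  have e w : w * (1 - gamma * c ^+ 2) = w * gamma * c * (a - c).
    by rewrite -gac; ring.
  by rewrite /stationarity !e /c; split; ring.
split=> [[y_stat z_stat] | [gac yz_s]]; last first.
  by have [-> ->] := factor gac; rewrite yz_s subrr mulr0.
have gac : gamma * a * c = 1.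
  apply: (mulIf yz0); rewrite mul1r; apply/eqP; rewrite -subr_eq0.
  rewrite -[X in _ == X]subr0 -{1}z_stat -y_stat /stationarity /c.
  by apply/eqP; ring.
split=> //; have [y_factor _] := factor gac.
have c_neq0 := stationary_loop_neq0 y_stat z_stat.
have gc_neq0 : gamma * c != 0 by rewrite mulf_neq0 // gt_eqF.
move/eqP: y_stat; rewrite y_factor mulf_eq0 (negPf gc_neq0) /=.
by rewrite subr_eq0 => /eqP.
Qed.

Lemma loop_cubic_asymmetric (c : R) :
  gamma * a * c = 1 -> gamma * a * loop_cubic c = gamma * (4 * s - (c - a) ^+ 2).
Proof.
move=> gac; rewrite /loop_cubic.
have -> : gamma * a * (- gamma * c ^+ 3
                       + (2 + 4 * gamma * s + gamma * a ^+ 2) * c - 2 * a)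
  = - gamma * (gamma * a * c) * c ^+ 2
    + (2 + 4 * gamma * s + gamma * a ^+ 2) * (gamma * a * c)
    - 2 * gamma * a ^+ 2 by ring.
rewrite gac.
have -> : gamma * (4 * s - (c - a) ^+ 2)
  = gamma * 4 * s - gamma * c ^+ 2 - gamma * a ^+ 2 + 2 * (gamma * a * c).
  by ring.
by rewrite gac; ring.
Qed.
End SymmetricStationary.

(** * The equilibria of the symmetric game *)

Section Equilibria.
Variables (R : realType) (a gamma : R).
Hypotheses (gamma_gt0 : 0 < gamma) (gamma_le1 : gamma <= 1).

Lemma discounted_loop_lt1 (c : R) : `|c| < 1 -> gamma * c ^+ 2 < 1.
Proof.
move=> c_lt1; apply: (@le_lt_trans _ _ (c ^+ 2)).
  by rewrite ler_piMl ?sqr_ge0.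
by rewrite -real_normK ?num_real // expr_lt1.
Qed.

Lemma closed_loop_player (x : 'rV[R]_2) (i : 'I_2) :
  a + x 0 i + x 0 (other i) = closed_loop a x.
Proof.
rewrite /closed_loop.
by case: (ord2_cases i) => ->; rewrite ?other0 ?other1 // addrAC.
Qed.

Lemma stable_fneP (sigma r : 'I_2 -> R) (x : 'rV[R]_2) :
  (forall i, 0 < sigma i) -> (forall i, 0 < r i) ->
  stable_fne a gamma sigma r x <->
  `|closed_loop a x| < 1
  /\ forall i, stationarity gamma (sigma i) (x 0 i) (closed_loop a x) = 0.
Proof.
move=> sigma_gt0 r_gt0.
have player i : `|closed_loop a x| < 1 ->
    (forall s0 y, (value a gamma sigma r i s0 (x 0 i)%R (x 0 (other i))%R
                   <= value a gamma sigma r i s0 y (x 0 (other i))%R)%E) <->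
    stationarity gamma (sigma i) (x 0 i) (closed_loop a x) = 0.
  move=> /discounted_loop_lt1; rewrite -(closed_loop_player x i) => c_small.
  exact: best_response_stationarity.
split=> [[x_fne x_stable] | [x_stable x_stat]]; split=> //.
  by move=> i; apply/(player i x_stable) => s0 y; exact: x_fne.
by move=> s0 i y; exact: (player i x_stable).2 (x_stat i) s0 y.
Qed.

End Equilibria.

Section SymmetricEquilibrium.
Variables (R : realType) (a gamma s : R) (r : 'I_2 -> R).
Hypotheses (a_neq0 : a != 0) (gamma_gt0 : 0 < gamma) (gamma_le1 : gamma <= 1).
Hypotheses (s_gt0 : 0 < s) (r_gt0 : forall i, 0 < r i).
Variable x : 'rV[R]_2.
Hypotheses (x_sym : symmetric_profile x)
  (x_fne : stable_fne a gamma (fun=> s) r x).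

Let w := x 0 0.
Let c := closed_loop a x.

Let x_entry i : x 0 i = w.
Proof. by case: (ord2_cases i) => ->. Qed.

Let cE : c = a + w + w.
Proof. by rewrite /c /closed_loop !x_entry. Qed.

Let stableP y := @stable_fneP _ a _ gamma_gt0 gamma_le1 (fun=> s) r y
                   (fun=> s_gt0) r_gt0.

Let c_lt1 : `|c| < 1. Proof. by have [] := x_fne. Qed.

Let c_small : gamma * c ^+ 2 < 1. Proof. exact: discounted_loop_lt1. Qed.

Let w_stat : stationarity gamma s w c = 0.
Proof. by have [_ x_stat] := (stableP x).1 x_fne; exact: x_stat. Qed.

Let c_root : loop_cubic a gamma s c = 0.
Proof. by rewrite cE loop_cubicE -cE w_stat mulr0. Qed.

Lemma saddle_iff_loop_gain :
  locally_saddle a gamma (fun=> s) x <-> 1 < gamma * a * c.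
Proof.
pose b := a + w.
pose A := gamma * b ^+ 2 + 2 * gamma * w * b - (1 + gamma * s).
pose B := 2 * gamma * w * b + gamma * (w ^+ 2 - s).
have c_neq0 : c != 0.
  have w_stat' : stationarity gamma s w (a + w + w) = 0 by rewrite -cE.
  rewrite cE; exact (stationary_loop_neq0 a_neq0 w_stat' w_stat').
have w_neq0 : w != 0.
  apply/eqP => w_eq0.
  have := stationary_opposes_loop gamma_gt0 s_gt0 c_small c_neq0 w_stat.
  by rewrite w_eq0 mul0r ltxx.
have J_entry j i : jacobian (F a gamma (fun=> s)) x j i = if j == i then A else B.
  by rewrite jacobianF //= ?x_entry // => k; rewrite x_entry.
have eigenP := eigenvalue_exchange J_entry.
have AB_lt0 : A + B < 0.
  by apply: symmetric_mode_negative; rewrite -?cE.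
have AB_gain : A - B = gamma * a * c - 1 by rewrite /A /B cE /b; ring.
split=> [[l [m [_ /eigenP m_eigen /andP[_ m_gt0]]]] | gain].
  by case: m_eigen m_gt0 => ->; lra.
exists (A + B), (A - B); split; first by apply/eigenP; left.
  by apply/eigenP; right.
by rewrite AB_lt0 AB_gain subr_gt0.
Qed.

(** Both sides compare signs of [loop_cubic] at d: multiplied by gamma * a it is
    gamma * (4 * s - (d - a) ^ 2), and by [loop_cubic_sign] it is also
    (1 - gamma * a * c) times a positive number. *)
Lemma discriminant_sign (d : R) :
  gamma * a * d = 1 -> gamma * d ^+ 2 < 1 ->
  (4 * s < (d - a) ^+ 2) = (1 < gamma * a * c).
Proof.
move=> gad d_small.
have [k k_gt0 d_cubic] :=
  loop_cubic_sign gamma_gt0 s_gt0 c_small d_small c_root.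
have := loop_cubic_asymmetric s gad.
rewrite d_cubic mulrA mulrBr gad => e.
rewrite -[LHS]subr_lt0 -[LHS](pmulr_rlt0 _ gamma_gt0) -e pmulr_llt0 //.
by rewrite subr_lt0.
Qed.

(** The new policies are the roots of Y ^ 2 - (d - a) * Y + s for
    d = 1 / (gamma * a). *)
Lemma other_fne_of_loop_gain :
  1 < gamma * a * c ->
  exists y : 'rV[R]_2, stable_fne a gamma (fun=> s) r y /\ y <> x.
Proof.
move=> gain.
have ga_neq0 : gamma * a != 0 by rewrite mulf_neq0 // gt_eqF.
pose d := (gamma * a)^-1.
have gad : gamma * a * d = 1 by rewrite divff.
have d_lt1 : `|d| < 1.
  apply: lt_trans c_lt1.
  have ga_gt0 : 0 < `|gamma * a| by rewrite normr_gt0.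
  rewrite -(ltr_pM2l ga_gt0) -!normrM gad normr1.
  exact: lt_le_trans gain (ler_norm _).
have disc : 0 < (d - a) ^+ 2 - 4 * s.
  by rewrite subr_gt0 discriminant_sign // discounted_loop_lt1.
pose q := Num.sqrt ((d - a) ^+ 2 - 4 * s).
have q2 : q ^+ 2 = (d - a) ^+ 2 - 4 * s by rewrite sqr_sqrtr // ltW.
have q_gt0 : 0 < q by rewrite sqrtr_gt0.
pose u := ((d - a) + q) / 2; pose v := ((d - a) - q) / 2.
have uv_neq : u != v by rewrite gt_eqF // /u /v; lra.
have uv_loop : a + u + v = d by rewrite /u /v; field.
pose y : 'rV[R]_2 := \row_i (if i == 0 then u else v).
have y0 : y 0 0 = u by rewrite mxE.
have y1 : y 0 1 = v by rewrite mxE.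
exists y; split; last first.
  move=> y_x; case/eqP: uv_neq.
  by rewrite -y0 -y1 y_x; exact: x_sym.
apply/stableP; rewrite /closed_loop y0 y1 uv_loop; split=> // i.
have [|u_stat v_stat] := (asymmetric_stationary s a_neq0 gamma_gt0 uv_neq).2.
  rewrite uv_loop; split=> //.
  have -> : u * v = ((d - a) ^+ 2 - q ^+ 2) / 4 by rewrite /u /v; field.
  by rewrite q2; field.
by rewrite -uv_loop; case: (ord2_cases i) => ->; rewrite ?y0 ?y1.
Qed.

Lemma loop_gain_of_other_fne (y : 'rV[R]_2) :
  stable_fne a gamma (fun=> s) r y -> y <> x -> 1 < gamma * a * c.
Proof.
move=> /stableP[]; set d := closed_loop a y => d_lt1 y_stat y_neq_x.
have d_small := discounted_loop_lt1 gamma_le1 d_lt1.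
have dE : d = a + y 0 0 + y 0 1 by [].
have [y_sym|y_asym] := eqVneq (y 0 0) (y 0 1).
  case: y_neq_x.
  have d_root : loop_cubic a gamma s d = 0.
    have d_sym : d = a + y 0 0 + y 0 0 by rewrite dE -y_sym.
    by rewrite d_sym loop_cubicE -d_sym y_stat mulr0.
  have [k k_gt0] := loop_cubic_sign gamma_gt0 s_gt0 c_small d_small c_root.
  rewrite d_root => /esym/eqP; rewrite mulf_eq0 (gt_eqF k_gt0) orbF subr_eq0.
  move=> /eqP d_c; apply/rowP => i; rewrite x_entry.
  by move: d_c; rewrite dE cE; case: (ord2_cases i) => ->; rewrite -?y_sym; lra.
have [gad y_prod] := (asymmetric_stationary s a_neq0 gamma_gt0 y_asym).1
  (conj (y_stat 0) (y_stat 1)).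
rewrite -(discriminant_sign gad d_small) -subr_gt0.
have -> : (a + y 0 0 + y 0 1 - a) ^+ 2 - 4 * s = (y 0 0 - y 0 1) ^+ 2.
  by rewrite -y_prod; ring.
by rewrite exprn_even_gt0 // subr_eq0.
Qed.

End SymmetricEquilibrium.

Theorem theorem5p2 (R : realType) (a gamma sigma : R) (r : 'I_2 -> R)
    (a_neq0 : a != 0) (gamma_gt0 : 0 < gamma) (gamma_le1 : gamma <= 1)
    (sigma_gt0 : 0 < sigma) (r_gt0 : forall i, 0 < r i)
    (x : 'rV[R]_2) (x_sym : symmetric_profile x)
    (x_fne : stable_fne a gamma (fun=> sigma) r x) :
  locally_saddle a gamma (fun=> sigma) x <->
  exists y : 'rV[R]_2, stable_fne a gamma (fun=> sigma) r y /\ y <> x.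
Proof.
apply: (iff_trans (saddle_iff_loop_gain a_neq0 gamma_gt0 gamma_le1 sigma_gt0
                     r_gt0 x_sym x_fne)).
split=> [|[y [y_fne y_neq_x]]].
  exact: other_fne_of_loop_gain.
exact: loop_gain_of_other_fne y_fne y_neq_x.
Qed.
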